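(* Let $P=\{P_n(x)\}_{n=0}^{\infty}$ be an orthogonal polynomial sequence on the real line that satisfies the Christoffel–Darboux identities $$\sum_{k=0}^{n}\frac{A_{k+1}}{C_0\cdots C_{k+1}}P_k(x)P_k(y)=\frac{1}{C_0\cdots C_{n+1}}\,\frac{P_{n+1}(x)P_n(y)-P_n(x)P_{n+1}(y)}{x-y},$$ $$\sum_{k=0}^{n}\frac{A_{k+1}}{C_0\cdots C_{k+1}}P_k^2(x)=\frac{P_{n+1}'(x)P_n(x)-P_n'(x)P_{n+1}(x)}{C_0\cdots C_{n+1}}.$$ Let $M(x)=\frac{ax+b}{cx+d}$ with $a,b,c,d\in\mathbb{C}$ and $\Delta=ad-bc\ne0$. Then the sequence $R=\{R_n(x)\}_{n=0}^{\infty}$ of Möbius-transformed rational functions $R_n(x)=P_n(M(x))$ satisfies the identities $$\sum_{k=0}^{n}\frac{A_{k+1}}{C_0\cdots C_{k+1}}R_k(x)R_k(y)=(cx+d)(cy+d)\left[\frac{R_{n+1}(x)R_n(y)-R_n(x)R_{n+1}(y)}{\Delta\,(C_0\cdots C_{n+1})(x-y)}\right],$$ $$\sum_{k=0}^{n}\frac{A_{k+1}}{C_0\cdots C_{k+1}}R_k^2(y)=(cy+d)^2\left[\frac{R_{n+1}'(y)R_n(y)-R_n'(y)R_{n+1}(y)}{\Delta\,(C_0\cdots C_{n+1})}\right].$$ Similarly, the sequence $Q=\{Q_n(x)\}_{n=0}^{\infty}$ of Möbius-transformed polynomials $Q_n(x)=(cx+d)^nP_n(M(x))$ satisfies the identities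 $$\sum_{k=0}^{n}\frac{A_{k+1}}{C_0\cdots C_{k+1}}\frac{Q_k(x)}{(cx+d)^k}\frac{Q_k(y)}{(cy+d)^k}=\frac{Q_{n+1}(x)Q_n(y)(cy+d)-(cx+d)Q_n(x)Q_{n+1}(y)}{\Delta\,(C_0\cdots C_{n+1})(cx+d)^n(cy+d)^n(x-y)},$$ $$\sum_{k=0}^{n}\frac{A_{k+1}}{C_0\cdots C_{k+1}}\frac{Q_k^2(x)}{(cx+d)^{2k}}=\frac{Q_{n+1}'(x)Q_n(x)-Q_n'(x)Q_{n+1}(x)-c\,Q_{n+1}(x)Q_n(x)}{\Delta\,(C_0\cdots C_{n+1})(cx+d)^{2n-1}}.$$
   Context: An orthogonal polynomial sequence on the real line is a sequence of polynomials $P_n$ with $\deg P_n=n$ such that $\int_l^rP_m(x)P_n(x)w(x)\,dx=K_m\delta_{m,n}$, $K_m>0$, for some interval $(l,r)\subseteq\mathbb{R}$ (finite, semi-infinite or infinite) and some continuous non-negative weight function $w$. The constants $A_n>0$, $C_n>0$ ($n\ge1$) are those of the three-term recurrence relation $P_n(x)=(A_nx-B_n)P_{n-1}(x)-C_nP_{n-2}(x)$, $n\ge1$, with $P_{-1}=0$, $P_0=1$ and $B_n$ real; $C_0$ is a fixed nonzero constant. The identities are understood for $n\ge0$ and at points where the denominators do not vanish and the functions involved are defined.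
   Formalization: In the last identity the term c Q_{n+1}(x)Q_n(x) is replaced by (c/(cx+d)) Q_{n+1}(x)Q_n(x); as printed the identity fails, e.g. for Legendre polynomials with M(x)=1/x and n=0, where it reads 1=x. *)

(* Defs.v *)
From HB Require Import structures.
From mathcomp Require Import all_boot all_order all_algebra.
From mathcomp Require Import all_classical all_reals all_analysis.
From mathcomp Require Export complex.

Set Implicit Arguments.
Unset Strict Implicit.
Unset Printing Implicit Defensive.

Import Order.TTheory GRing.Theory Num.Theory.
Import numFieldNormedType.Exports.

Local Open Scope classical_set_scope.
Local Open Scope ring_scope.
Local Open Scope complex_scope.

Section OrthogonalPolynomials.
Variable R : realType.
Implicit Types (P : nat -> {poly R}) (A B C : nat -> R).

(* The endpoints may be infinite. Integrability is required because the
   Lebesgue integral is a total operator. *)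
Definition orthogonal_polynomial_sequence P : Prop :=
  (forall n, size (P n) = n.+1) /\
  exists (l r : \bar R) (w : R -> R) (K : nat -> R),
    let I := [set x : R | (l < x%:E)%E /\ (x%:E < r)%E] in
    [/\ (l < r)%E,
        {within I, continuous w},
        (forall x, I x -> 0 <= w x),
        (forall m, 0 < K m) &
        forall m n : nat,
          (@lebesgue_measure R).-integrable I
             (fun x => ((P m).[x] * (P n).[x] * w x)%:E) /\
          Rintegral (@lebesgue_measure R) I
             (fun x => (P m).[x] * (P n).[x] * w x)
          = K m *+ (m == n)].

(* [A 0], [B 0] are unused; [C 0] is a normalisation constant that does not
   enter the recurrence. *)
Definition three_term_recurrence A B C P : Prop :=
  [/\ C 0%N != 0,
      (forall n, 0 < A n.+1 /\ 0 < C n.+1),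
      P 0%N = 1 &
      forall n, P n.+1 = (A n.+1 *: 'X - (B n.+1)%:P) * P n
                         - C n.+1 *: (if n is m.+1 then P m else 0)].

(* C_0 C_1 ... C_n *)
Definition prodC C (n : nat) : R := \prod_(i < n.+1) C i.

Definition christoffel_darboux A C P : Prop :=
  forall (n : nat) (x y : R), x != y ->
    \sum_(k < n.+1) A k.+1 / prodC C k.+1 * ((P k).[x] * (P k).[y])
    = (prodC C n.+1)^-1 *
      (((P n.+1).[x] * (P n).[y] - (P n).[x] * (P n.+1).[y]) / (x - y)).

Definition christoffel_darboux_confluent A C P : Prop :=
  forall (n : nat) (x : R),
    \sum_(k < n.+1) A k.+1 / prodC C k.+1 * (P k).[x] ^+ 2
    = ((deriv (P n.+1)).[x] * (P n).[x] - (deriv (P n)).[x] * (P n.+1).[x])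
      / prodC C n.+1.

Definition moebius (a b c d x : R[i]) : R[i] := (a * x + b) / (c * x + d).

(* [R_n(x) = P_n(M(x))], with [P_n] evaluated at a complex point *)
Definition moebius_rational P (a b c d : R[i]) (n : nat) (x : R[i]) : R[i] :=
  (map_poly (real_complex R) (P n)).[moebius a b c d x].

(* [Q_n(x) = (c x + d)^n P_n(M(x))] *)
Definition moebius_polynomial P (a b c d : R[i]) (n : nat) (x : R[i]) : R[i] :=
  (c * x + d) ^+ n * (map_poly (real_complex R) (P n)).[moebius a b c d x].

Definition complex_derivative (f : R[i] -> R[i]) (z : R[i]) : R[i] :=
  derive1 (f : R[i] -> R[i]^o) z.

End OrthogonalPolynomials.

(* Main.v *)
(* Over any field, the three-term recurrence alone yields both
   Christoffel-Darboux identities: if [W_n] is the Casoratian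
   [p_(n+1)(x) p_n(y) - p_n(x) p_(n+1)(y)] (or the Wronskian
   [p_(n+1)' p_n - p_n' p_(n+1)]), the recurrence gives
   [W_n = A_(n+1) (x - y) p_n(x) p_n(y) + C_(n+1) W_(n-1)] (without [x - y] for
   the Wronskian), which telescopes. As the recurrence is preserved by the
   embedding of the reals in the complex numbers, the identities hold at the
   complex points [M x], [M y]. Finally
   [M x - M y = Delta (x - y) / ((c x + d) (c y + d))] and
   [M' x = Delta / (c x + d)^2]. *)

Require Import Defs.
From HB Require Import structures.
From mathcomp Require Import all_boot all_order all_algebra.
From mathcomp Require Import all_classical all_reals all_analysis.
From mathcomp Require Import ring.

Set Implicit Arguments.
Unset Strict Implicit.
Unset Printing Implicit Defensive.

Import Order.TTheory GRing.Theory Num.Theory.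
Import numFieldNormedType.Exports.

Local Open Scope ring_scope.
Local Open Scope complex_scope.

Section ChristoffelDarboux.
Variables (F : fieldType) (p : nat -> {poly F}) (A B C : nat -> F).
Hypothesis C_neq0 : forall n, C n != 0.
Hypothesis p0 : p 0%N = 1.
Hypothesis pS : forall n, p n.+1 = (A n.+1 *: 'X - (B n.+1)%:P) * p n
                                   - C n.+1 *: (if n is m.+1 then p m else 0).

Let D n := \prod_(i < n.+1) C i.

Let D_neq0 n : D n != 0.
Proof. by apply/prodf_neq0 => i _; exact: C_neq0. Qed.

Let DS n : D n.+1 = D n * C n.+1.
Proof. by rewrite /D big_ord_recr. Qed.

(** Keeping [x - y] as a factor makes the identity valid for all points. In the induction step the
    [B] terms cancel by antisymmetry in [x] and [y], and the [C] term, divided by [D n.+2], is the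
    previous right-hand side. *)
Lemma christoffel_darboux_casoratian n x y :
  (x - y) * \sum_(k < n.+1) A k.+1 / D k.+1 * ((p k).[x] * (p k).[y])
  = ((p n.+1).[x] * (p n).[y] - (p n).[x] * (p n.+1).[y]) / D n.+1.
Proof.
elim: n => [|n IH].
  rewrite big_ord1 pS p0 !hornerE /=; field.
  exact: D_neq0.
rewrite big_ord_recr /= mulrDr IH (pS n.+1) !hornerE /= (DS n.+1).
field.
by rewrite D_neq0 C_neq0.
Qed.

(** No limit [y -> x] is taken: the same induction runs on formal derivatives, the new summand
    coming from the derivative [A n.+2] of the linear factor in the recurrence. *)
Lemma christoffel_darboux_wronskian n x :
  \sum_(k < n.+1) A k.+1 / D k.+1 * (p k).[x] ^+ 2
  = ((p n.+1)^`().[x] * (p n).[x] - (p n)^`().[x] * (p n.+1).[x]) / D n.+1.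
Proof.
elim: n => [|n IH].
  rewrite big_ord1 pS p0 !poly.derivE !hornerE /=; field.
  exact: D_neq0.
rewrite big_ord_recr /= IH (pS n.+1) (DS n.+1) !poly.derivE !hornerE /=.
field.
by rewrite D_neq0 C_neq0.
Qed.

End ChristoffelDarboux.

Section ComplexDerivative.
Variable K : numFieldType.
Implicit Types (f : K -> K) (p : {poly K}).

(** Chain rule linking formal and analytic derivatives. Along the Horner scheme, [p * 'X + r]
    evaluated at [f] is a product with [f] plus a constant, so the product rule suffices. *)
Lemma is_derive_horner_comp p f x df : is_derive x (1 : K) f df ->
  is_derive x (1 : K) (fun z => p.[f z]) (p^`().[f x] * df).
Proof.
move=> fx; elim/poly_ind: p => [|p r IH].
  rewrite (_ : (fun z => _) = cst 0); last by apply/funext => z; rewrite horner0.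
  by rewrite poly.derivE horner0 mul0r; exact: is_derive_cst.
rewrite (_ : (fun z => _) = ((fun z => p.[f z]) * f) + cst r); last first.
  by apply/funext => z; rewrite !fctE !hornerE.
apply: is_derive_eq.
by rewrite !poly.derivE !hornerE /GRing.scale /=; ring.
Qed.

Lemma is_derive_affine (a b x : K) :
  is_derive x (1 : K) (fun z => a * z + b) a.
Proof.
have := is_derive_horner_comp (a *: 'X + b%:P) (is_derive_id x 1).
rewrite !poly.derivE !hornerE.
by rewrite (_ : (fun z => _) = (fun z => a * z + b))//;
  apply/funext => z; rewrite !hornerE.
Qed.

(** The product rule gives the numerator [a (c x + d) - c (a x + b)], which collapses to
    [a d - b c]. *)
Lemma is_derive_moebius (a b c d x : K) : c * x + d != 0 ->
  is_derive x (1 : K) (fun z => (a * z + b) / (c * z + d))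
    ((a * d - b * c) / (c * x + d) ^+ 2).
Proof.
move=> u0; have dn := is_derive_affine a b x.
have du := is_derive_affine c d x.
have dv : is_derive x (1 : K) (fun z => (c * z + d)^-1)
    (- (c * x + d) ^- 2 *: c).
  by apply: DeriveDef; [exact: derivableV | rewrite deriveV // derive_val].
apply: (is_derive_eq (is_deriveM dn dv)).
by rewrite /GRing.scale /=; field.
Qed.

(** The truncated exponent [n.-1] is harmless at [n = 0], where the factor [n%:R] vanishes. *)
Lemma is_derive_moebius_horner p (a b c d x : K) n : c * x + d != 0 ->
  is_derive x (1 : K)
    (fun z => (c * z + d) ^+ n * p.[(a * z + b) / (c * z + d)])
    ((c * x + d) ^+ n * p^`().[(a * x + b) / (c * x + d)]
       * ((a * d - b * c) / (c * x + d) ^+ 2)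
     + n%:R * c * (c * x + d) ^+ n.-1 * p.[(a * x + b) / (c * x + d)]).
Proof.
move=> u0; have dp := is_derive_horner_comp p (is_derive_moebius a b u0).
(* The power is read as ['X^n] evaluated at an affine map, so the same chain rule covers it. *)
have du := is_derive_horner_comp 'X^n (is_derive_affine c d x).
have -> : (fun z => (c * z + d) ^+ n * p.[(a * z + b) / (c * z + d)]) =
    (fun z => 'X^n.[c * z + d]) * (fun z => p.[(a * z + b) / (c * z + d)]).
  by apply/funext => z; rewrite fctE hornerXn.
apply: (is_derive_eq (is_deriveM du dp)).
rewrite /GRing.scale /= derivXn hornerMn !hornerXn -mulr_natl; ring.
Qed.

End ComplexDerivative.

Section MoebiusTransform.
Variables (R : realType) (P : nat -> {poly R}) (a b c d : R[i]).
Local Notation p n := (map_poly (real_complex R) (P n)).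
Local Notation M := (moebius a b c d).

Lemma complex_derivative_moebius_polynomial n x : c * x + d != 0 ->
  complex_derivative (moebius_polynomial P a b c d n) x =
    (c * x + d) ^+ n * (p n)^`().[M x] * ((a * d - b * c) / (c * x + d) ^+ 2)
    + n%:R * c * (c * x + d) ^+ n.-1 * (p n).[M x].
Proof.
move=> u0; rewrite /complex_derivative derive1E.
exact: (@derive_val _ _ _ _ _ _ _ (is_derive_moebius_horner (p n) a b n u0)).
Qed.

Lemma complex_derivative_moebius_rational n x : c * x + d != 0 ->
  complex_derivative (moebius_rational P a b c d n) x =
    (p n)^`().[M x] * ((a * d - b * c) / (c * x + d) ^+ 2).
Proof.
move=> u0; rewrite /complex_derivative derive1E.
exact: (@derive_val _ _ _ _ _ _ _
  (is_derive_horner_comp (p n) (is_derive_moebius a b u0))).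
Qed.

End MoebiusTransform.

Theorem theorem5 (R : realType) (P : nat -> {poly R}) (A B C : nat -> R)
    (hP : orthogonal_polynomial_sequence P)
    (hrec : three_term_recurrence A B C P)
    (hCD : christoffel_darboux A C P)
    (hCD' : christoffel_darboux_confluent A C P)
    (a b c d : R[i]) (hDelta : a * d - b * c != 0) :
  let Delta := a * d - b * c in
  let Rn := moebius_rational P a b c d in
  let Q := moebius_polynomial P a b c d in
  [/\ (forall (n : nat) (x y : R[i]),
         c * x + d != 0 -> c * y + d != 0 -> x != y ->
         \sum_(k < n.+1) (A k.+1 / prodC C k.+1)%:C * (Rn k x * Rn k y)
         = (c * x + d) * (c * y + d) *
           ((Rn n.+1 x * Rn n y - Rn n x * Rn n.+1 y)
            / (Delta * (prodC C n.+1)%:C * (x - y)))),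
      (forall (n : nat) (y : R[i]),
         c * y + d != 0 ->
         \sum_(k < n.+1) (A k.+1 / prodC C k.+1)%:C * Rn k y ^+ 2
         = (c * y + d) ^+ 2 *
           ((complex_derivative (Rn n.+1) y * Rn n y - complex_derivative (Rn n) y * Rn n.+1 y)
            / (Delta * (prodC C n.+1)%:C))),
      (forall (n : nat) (x y : R[i]),
         c * x + d != 0 -> c * y + d != 0 -> x != y ->
         \sum_(k < n.+1) (A k.+1 / prodC C k.+1)%:C
            * (Q k x / (c * x + d) ^+ k) * (Q k y / (c * y + d) ^+ k)
         = (Q n.+1 x * Q n y * (c * y + d) - (c * x + d) * Q n x * Q n.+1 y)
           / (Delta * (prodC C n.+1)%:C
              * (c * x + d) ^+ n * (c * y + d) ^+ n * (x - y))) &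
      (forall (n : nat) (x : R[i]),
         c * x + d != 0 ->
         \sum_(k < n.+1) (A k.+1 / prodC C k.+1)%:C
            * (Q k x ^+ 2 / (c * x + d) ^+ (2 * k))
         = (complex_derivative (Q n.+1) x * Q n x - complex_derivative (Q n) x * Q n.+1 x
            - c / (c * x + d) * Q n.+1 x * Q n x)
           / (Delta * (prodC C n.+1)%:C
              * (c * x + d) ^ (2%:Z * n%:Z - 1)))].
Proof.
move=> Delta Rn Q.
have [C0 AC P0 PS] := hrec.
pose p n := map_poly (real_complex R) (P n).
pose M := moebius a b c d.
have Cn0 n : (C n)%:C != 0.
  rewrite fmorph_eq0; case: n => [//|n].
  by rewrite gt_eqF //; have [] := AC n.
have p0 : p 0%N = 1 by rewrite /p P0 rmorph1.
have pS n : p n.+1 = ((A n.+1)%:C *: 'X - ((B n.+1)%:C)%:P) * p n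
                     - (C n.+1)%:C *: (if n is m.+1 then p m else 0).
  rewrite /p PS rmorphB rmorphM rmorphB /= !map_polyZ map_polyX map_polyC /=.
  by case: n => [|n] //; rewrite rmorph0.
have DE n : (prodC C n)%:C = \prod_(i < n.+1) (C i)%:C by exact: rmorph_prod.
have D0 n : (prodC C n)%:C != 0 by rewrite DE; apply/prodf_neq0.
have wE k : (A k.+1 / prodC C k.+1)%:C =
    (A k.+1)%:C / \prod_(i < k.+2) (C i)%:C.
  by rewrite rmorphM fmorphV /= -DE.
have CDcas := @christoffel_darboux_casoratian _ p
  (fun k => (A k)%:C) (fun k => (B k)%:C) _ Cn0 p0 pS.
have CDwr := @christoffel_darboux_wronskian _ p
  (fun k => (A k)%:C) (fun k => (B k)%:C) _ Cn0 p0 pS.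
have CD n x y : (x - y) *
    \sum_(k < n.+1) (A k.+1 / prodC C k.+1)%:C * ((p k).[x] * (p k).[y])
    = ((p n.+1).[x] * (p n).[y] - (p n).[x] * (p n.+1).[y])
      / (prodC C n.+1)%:C.
  under eq_bigr do rewrite wE.
  by rewrite DE; exact: (CDcas n x y).
have RE n x : (p n).[M x] = Rn n x by [].
have sumR n x y : c * x + d != 0 -> c * y + d != 0 -> x != y ->
    \sum_(k < n.+1) (A k.+1 / prodC C k.+1)%:C * (Rn k x * Rn k y)
    = (c * x + d) * (c * y + d) *
      ((Rn n.+1 x * Rn n y - Rn n x * Rn n.+1 y)
       / (Delta * (prodC C n.+1)%:C * (x - y))).
  move=> ux uy xy; have xy0 : x - y != 0 by rewrite subr_eq0.
  have Mxy : M x - M y = Delta * (x - y) / ((c * x + d) * (c * y + d)).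
    by rewrite /M /moebius /Delta; field; rewrite ux uy.
  (* [M] is injective away from its pole since [Delta] is nonzero; the factor [M x - M y] of the
     Casoratian identity can therefore be cancelled. *)
  have Mxy0 : M x - M y != 0.
    by rewrite Mxy mulf_neq0 ?invr_eq0 ?mulf_neq0.
  apply: (mulfI Mxy0); rewrite CD Mxy -!RE.
  by field; rewrite ux uy xy0 D0 hDelta.
(* Common source of both confluent identities: the derivatives are still formal ones at [M y], and
   [M'] enters only when they are traded for complex derivatives. *)
have sumR' n y :
    \sum_(k < n.+1) (A k.+1 / prodC C k.+1)%:C * Rn k y ^+ 2
    = ((p n.+1)^`().[M y] * Rn n y - (p n)^`().[M y] * Rn n.+1 y)
      / (prodC C n.+1)%:C.
  under eq_bigr do rewrite wE.
  by rewrite -!RE DE; exact: (CDwr n (M y)).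
have QE n x : Q n x = (c * x + d) ^+ n * Rn n x by [].
split=> // [n y uy|n x y ux uy xy|n x ux].
- rewrite sumR' // !complex_derivative_moebius_rational //.
  rewrite -/Delta -!/(p _) -/M; field.
  by rewrite uy D0 hDelta.
- transitivity (\sum_(k < n.+1)
      (A k.+1 / prodC C k.+1)%:C * (Rn k x * Rn k y)).
    by apply: eq_bigr => k _; rewrite !QE; field; rewrite D0 !expf_neq0.
  (* The extra factors [c y + d] and [c x + d] balance the degrees, so both products carry
     [(c x + d) ^+ n.+1] and [(c y + d) ^+ n.+1]. *)
  rewrite sumR // !QE !exprS; field.
  by rewrite subr_eq0 xy D0 hDelta !expf_neq0.
- transitivity (\sum_(k < n.+1) (A k.+1 / prodC C k.+1)%:C * Rn k x ^+ 2).
    apply: eq_bigr => k _; rewrite QE exprMn -exprM mulnC.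
    by field; rewrite D0 expf_neq0.
  rewrite sumR' // !complex_derivative_moebius_polynomial //.
  rewrite -/Delta -!/(p _) -/M -!RE !QE.
  (* The exponent is [-1] at [n = 0], hence an integer power. It and [n.-1] are rewritten through
     [(c x + d) ^+ n] so that [field] can treat that power as an atom. *)
  have -> : (c * x + d) ^ (2%:Z * n%:Z - 1)
      = (c * x + d) ^+ n ^+ 2 / (c * x + d).
    by rewrite expfzDr // -PoszM -exprnP mulnC exprM.
  have -> : n%:R * c * (c * x + d) ^+ n.-1
      = n%:R * c * (c * x + d) ^+ n / (c * x + d).
    by case: n => [|n]; rewrite ?mul0r // exprSr mulrA mulfK.
  (* Differentiating the prefactors of [Q n.+1] and [Q n] contributes [n + 1] and [n] copies of
     [c / (c x + d) * Q n.+1 x * Q n x] with opposite signs; the one copy left over is the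
     correction term subtracted in the identity. *)
  rewrite !(exprS _ n) -!/(p _) !RE /= -natr1; field.
  by rewrite ux D0 hDelta expf_neq0.
Qed.
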